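(* Let $(M,g,\nabla)$ be a compact statistical manifold. For an arbitrary number $L\in\mathbb{R}$ there exists a sufficiently small radius $r>0$ such that the absolute value of the mean curvature $H$ of the sphere bundle $S^rM$ in $TM$ is greater than $L$ everywhere on $S^rM$.
   Context: All objects are smooth. A statistical manifold $(M,g,\nabla)$ is a manifold $M$ with a (positive definite) Riemannian metric $g$ and a torsion-free affine connection $\nabla$ such that $(\nabla_Xg)(Y,Z)=(\nabla_Yg)(X,Z)$ for all $X,Y,Z$. Let $\pi:TM\to M$ be the tangent bundle. For $\xi,X\in T_pM$: the vertical lift $X^v_\xi\in T_\xi TM$ is the velocity at $t=0$ of the curve $t\mapsto \xi+tX$; the horizontal lift $X^h_\xi\in T_\xi TM$ is the velocity at $t=0$ of the curve $t\mapsto\xi_t$ obtained by $\nabla$-parallel transport of $\xi$ along the $\nabla$-geodesic with initial velocity $X$. One has $T_\xi TM=\{X^v_\xi\}\oplus\{X^h_\xi\}$, both lifts being linear and injective in $X$. $TM$ is equipped with the Sasakian metric $\tilde g$ determined by $g$ and $\nabla$: the Riemannian metric with $\tilde g(X^v,Y^v)=g(X,Y)=\tilde g(X^h,Y^h)$ and $\tilde g(X^v,Y^h)=0$. For $r>0$, $S^rM=\{\xi\in TM:\ g(\xi,\xi)=r^2\}$, a hypersurface of $(TM,\tilde g)$ equipped with the induced metric. Its second fundamental form is $\mathfrak h(A,B)=\tilde g(\nabla^{\tilde g}_AB,\mathcal N)$, where $\nabla^{\tilde g}$ is the Levi-Civita connection of $\tilde g$ and $\mathcal N$ is a unit normal field.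 The mean curvature $H$ is the (unnormalized) trace of $\mathfrak h$ with respect to the induced metric.
   Formalization: The dimension of M is assumed to be different from 1; in dimension 1 the claim is false (for the flat circle with its Levi-Civita connection, S^rM consists of two closed geodesics of a flat cylinder, so H = 0 for every r). *)

(* Defs.v *)
From HB Require Import structures.
From mathcomp Require Import all_boot all_order all_algebra.
From mathcomp Require Import all_classical all_reals all_analysis.

Set Implicit Arguments.
Unset Strict Implicit.
Unset Printing Implicit Defensive.
Import Order.TTheory GRing.Theory Num.Theory.
Import numFieldNormedType.Exports.

Local Open Scope classical_set_scope.
Local Open Scope ring_scope.

Section Smooth.
Variables (R : realType) (V W : normedModType R).

(* On a finite-dimensional V this is membership in C^k(U). *)
Fixpoint Ck (k : nat) (U : set V) (f : V -> W) : Prop :=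
  match k with
  | 0 => forall x, U x -> {for x, continuous f}
  | k'.+1 => (forall x, U x -> differentiable f x) /\
             forall v, Ck k' U (fun x => 'D_v f x)
  end.

Definition smooth_on (U : set V) (f : V -> W) : Prop := forall k, Ck k U f.

Definition smooth_near (x : V) (f : V -> W) : Prop :=
  exists2 U : set V, open_nbhs x U & smooth_on U f.

End Smooth.

Definition velocity (R : realType) (m : nat) (c : R -> 'rV[R]_m) (t : R) :
  'rV[R]_m := derive1 c t.

(* The images of the charts of a manifold and the transition maps between them:
   everything needed to express tensor fields and connections in coordinates.
   [overlap i j] is the part of [chart_image i] on which [transition i j] (the
   passage from chart i to chart j) is defined. *)
Record charts (R : realType) (m : nat) := Charts {
  chart_index : Type;
  chart_image : chart_index -> set 'rV[R]_m;
  overlap : chart_index -> chart_index -> set 'rV[R]_m;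
  transition : chart_index -> chart_index -> 'rV[R]_m -> 'rV[R]_m
}.
Arguments Charts {R m chart_index}.
Arguments chart_image {R m} c i.
Arguments overlap {R m} c i j.
Arguments transition {R m} c i j.

(* Any smooth atlas is allowed, a maximal one in particular. *)
Record smooth_manifold (R : realType) (M : topologicalType) (n : nat) :=
  SmoothManifold {
  chart : Type;
  chart_dom : chart -> set M;
  chart_map : chart -> M -> 'rV[R]_n;
  chart_inv : chart -> 'rV[R]_n -> M;
  manifold_hausdorff : hausdorff_space M;
  manifold_second_countable : @second_countable M;
  chart_dom_open : forall i, open (chart_dom i);
  chart_cover : forall p, exists i, chart_dom i p;
  chart_map_open : forall i, open (chart_map i @` chart_dom i);
  chart_mapK : forall i p, chart_dom i p -> chart_inv i (chart_map i p) = p;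
  chart_map_continuous : forall i p, chart_dom i p ->
    {for p, continuous (chart_map i)};
  chart_inv_continuous : forall i x, (chart_map i @` chart_dom i) x ->
    {for x, continuous (chart_inv i)};
  transition_smooth : forall i j,
    smooth_on (chart_map i @` (chart_dom i `&` chart_dom j))
              (chart_map j \o chart_inv i)
}.

Definition charts_of (R : realType) (M : topologicalType) (n : nat)
    (A : smooth_manifold R M n) : charts R n :=
  Charts (fun i : chart A => chart_map i @` chart_dom i)
         (fun i j => chart_map i @` (chart_dom i `&` chart_dom j))
         (fun i j => chart_map j \o chart_inv i).

(* The charts (x, y) induced on the tangent bundle by charts x: the point
   [row_mx x y] stands for the tangent vector with components y at the point
   with coordinates x, so transition maps act on y by their differential. *)
Definition tangent_charts (R : realType) (n : nat) (C : charts R n) :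
    charts R (n + n) :=
  Charts (fun i => [set z | chart_image C i (lsubmx z)])
         (fun i j => [set z | overlap C i j (lsubmx z)])
         (fun i j z => row_mx (transition C i j (lsubmx z))
                              ('D_(rsubmx z) (transition C i j) (lsubmx z))).

Section Tensors.
Variables (R : realType) (m : nat).
Implicit Types (x X Y Z : 'rV[R]_m).

Definition bil (g : 'M[R]_m) X Y : R := (X *m g *m Y^T) 0 0.

(* In [G k], the (a, b) entry is the Christoffel symbol with upper index k and
   lower indices a, b; [christoffel G X Y] is nabla_X Y for X and Y with
   constant components. *)
Definition christoffel (G : 'I_m -> 'M[R]_m) X Y : 'rV[R]_m :=
  \row_k bil (G k) X Y.

(* (nabla_X g)(Y, Z) at x. *)
Definition nabla_metric (g : 'rV[R]_m -> 'M[R]_m)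
    (G : 'rV[R]_m -> 'I_m -> 'M[R]_m) x X Y Z : R :=
  'D_X (fun w => bil (g w) Y Z) x
  - bil (g x) (christoffel (G x) X Y) Z - bil (g x) Y (christoffel (G x) X Z).

Definition cov_deriv (G : 'rV[R]_m -> 'I_m -> 'M[R]_m) x X
    (B : 'rV[R]_m -> 'rV[R]_m) : 'rV[R]_m :=
  'D_X B x + christoffel (G x) X (B x).

Definition cov_deriv_along (G : 'rV[R]_m -> 'I_m -> 'M[R]_m)
    (c e : R -> 'rV[R]_m) (t : R) : 'rV[R]_m :=
  velocity e t + christoffel (G (c t)) (velocity c t) (e t).

Variable C : charts R m.

Definition metric_field := chart_index C -> 'rV[R]_m -> 'M[R]_m.
Definition christoffel_field := chart_index C -> 'rV[R]_m -> 'I_m -> 'M[R]_m.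

Definition riemannian (g : metric_field) : Prop :=
  [/\ forall i, smooth_on (chart_image C i) (g i),
      forall i x, chart_image C i x -> (g i x)^T = g i x,
      forall i x X, chart_image C i x -> X != 0 -> 0 < bil (g i x) X X
    & forall i j x X Y, overlap C i j x ->
        bil (g i x) X Y =
        bil (g j (transition C i j x))
            ('D_X (transition C i j) x) ('D_Y (transition C i j) x)].

(* The second clause says that nabla_X Y transforms as a tangent vector. *)
Definition connection (G : christoffel_field) : Prop :=
  (forall i k, smooth_on (chart_image C i) (fun x => G i x k)) /\
  forall i j x X Y, overlap C i j x ->
    let t := transition C i j in
    'D_(christoffel (G i x) X Y) t x =
    'D_X (fun w => 'D_Y t w) x
    + christoffel (G j (t x)) ('D_X t x) ('D_Y t x).

Definition torsion_free (G : christoffel_field) : Prop :=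
  forall i x X Y, chart_image C i x ->
    christoffel (G i x) X Y = christoffel (G i x) Y X.

Definition statistical (g : metric_field) (G : christoffel_field) : Prop :=
  [/\ riemannian g, connection G, torsion_free G
    & forall i x X Y Z, chart_image C i x ->
        nabla_metric (g i) (G i) x X Y Z = nabla_metric (g i) (G i) x Y X Z].

Definition levi_civita (g : metric_field) (G : christoffel_field) : Prop :=
  [/\ connection G, torsion_free G
    & forall i x X Y Z, chart_image C i x ->
        nabla_metric (g i) (G i) x X Y Z = 0].

End Tensors.

Section Sasaki.
Variables (R : realType) (n : nat) (C : charts R n).
Variables (g : metric_field C) (G : christoffel_field C).
Implicit Types (z W Z : 'rV[R]_(n + n)) (X Y : 'rV[R]_n).

Definition vertical_lift z X : 'rV[R]_(n + n) :=
  velocity (fun t : R => row_mx (lsubmx z) (rsubmx z + t *: X)) 0.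

(* The curve c in the tangent bundle consists, near time 0, of a geodesic with
   initial velocity X and of a vector parallel along it, equal to z at 0. *)
Definition horizontal_curve (i : chart_index C) z X (c : R -> 'rV[R]_(n + n)) :
    Prop :=
  let p := fun t => lsubmx (c t) in
  let v := fun t => rsubmx (c t) in
  [/\ smooth_near (0 : R^o) c,
      \forall t \near (0 : R), chart_image C i (p t),
      \forall t \near (0 : R), cov_deriv_along (G i) p (velocity p) t = 0,
      \forall t \near (0 : R), cov_deriv_along (G i) p v t = 0
    & c 0 = z /\ velocity p 0 = X].

(* By the existence and uniqueness theorem for ordinary differential equations,
   horizontal curves with given i, z, X exist and have a common germ at 0, so
   exactly one W satisfies this. *)
Definition horizontal_lift (i : chart_index C) z X W : Prop :=
  forall c, horizontal_curve i z X c -> velocity c 0 = W.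

Definition sasakian (Gt : metric_field (tangent_charts C)) : Prop :=
  riemannian Gt /\
  forall (i : chart_index C) z X Y, chart_image (tangent_charts C) i z ->
    [/\ bil (Gt i z) (vertical_lift z X) (vertical_lift z Y)
          = bil (g i (lsubmx z)) X Y,
        forall W Z, horizontal_lift i z X W -> horizontal_lift i z Y Z ->
          bil (Gt i z) W Z = bil (g i (lsubmx z)) X Y
      & forall Z, horizontal_lift i z Y Z ->
          bil (Gt i z) (vertical_lift z X) Z = 0].

(* The part of the sphere bundle of radius r lying in chart i. *)
Definition sphere_bundle (r : R) (i : chart_index C) : set 'rV[R]_(n + n) :=
  [set z | chart_image (tangent_charts C) i z /\
           bil (g i (lsubmx z)) (rsubmx z) (rsubmx z) = r ^+ 2].

End Sasaki.

Section Hypersurface.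
Variables (R : realType) (m : nat).
Variables (g : 'rV[R]_m -> 'M[R]_m) (G : 'rV[R]_m -> 'I_m -> 'M[R]_m).
Variable S : set 'rV[R]_m.
Implicit Types (z N X : 'rV[R]_m).

Definition tangent_at z X : Prop :=
  exists c : R -> 'rV[R]_m,
    [/\ smooth_near (0 : R^o) c, \forall t \near (0 : R), S (c t), c 0 = z
      & velocity c 0 = X].

Definition unit_normal z N : Prop :=
  bil (g z) N N = 1 /\ forall X, tangent_at z X -> bil (g z) N X = 0.

Definition tangent_field z (B : 'rV[R]_m -> 'rV[R]_m) : Prop :=
  smooth_near z B /\ \forall w \near z, S w -> tangent_at w (B w).

Definition second_fundamental_form z N X (B : 'rV[R]_m -> 'rV[R]_m) : R :=
  bil (g z) (cov_deriv G z X B) N.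

(* Trace of the second fundamental form h with respect to the induced metric I:
   in a basis of the tangent space of S at z (the rows of E, extended to
   tangent fields B k), it is the trace of the matrix I^-1 h. *)
Definition mean_curvature z N (H : R) : Prop :=
  exists (E : 'M[R]_(m.-1, m)) (B : 'I_m.-1 -> 'rV[R]_m -> 'rV[R]_m),
    [/\ row_free E,
        forall k, tangent_at z (row k E),
        forall k, tangent_field z (B k) /\ B k z = row k E
      & H = \tr (invmx (E *m g z *m E^T) *m
                 \matrix_(k, l) second_fundamental_form z N (row k E) (B l))].

End Hypersurface.

(* Main.v *)
Require Import Defs.
From mathcomp Require Import all_boot all_order all_algebra.
From mathcomp Require Import all_classical all_reals all_analysis.
From mathcomp Require Import lra.
Import Order.TTheory GRing.Theory Num.Theory.
Import numFieldNormedType.Exports.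
Local Open Scope classical_set_scope.
Local Open Scope ring_scope.

(** The sphere bundle of radius r is the level set F = r^2 of the function
F(xi) = g(xi, xi) on the tangent bundle, so everything is read off from the
differential dF and the covariant Hessian Hess F = nabla dF of F for the
Levi-Civita connection of the Sasakian metric Gt.

On a level set, a unit normal N satisfies dF = lambda Gt(N, .) with
lambda = dF(N), and differentiating dF(B) = 0 along the level set for tangent
fields B gives lambda h = - Hess F on tangent vectors
([derive_tangent_field]).  Taking traces over the tangent space, which is the
Gt-orthogonal of N ([tr_hyperplane]),
  lambda H = - (tr_Gt Hess F - Hess F(N, N))    ([mean_curvature_level]).

Both sides are controlled near the zero section by their values there.  At a
zero vector, horizontal lifts are tangent to the zero section, so that Gt is
the orthogonal sum of two copies of g; F vanishes to second order, hence
dF = 0, and Hess F is twice the vertical copy of g.  So tr_Gt Hess F = 2n while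
Hess F(N, N) <= 2 Gt(N, N), and by continuity, near the zero section, the
parenthesis is at least 1 as soon as n >= 2 and |lambda| is as small as
desired.  This is the property [pinched]; the estimates hold uniformly in N
because being positive definite is an open condition ([near_posdef]).  Hence
|H| >= 1 / |lambda| is large on spheres of small radius.

The charts of an atlas may be infinitely many and badly behaved near their
boundary, so the uniformity in the base point comes from the compactness of M
together with the invariance of the pinching under changes of charts
([pinched_at_transition]): Hess F transforms as a tensor since a connection
transforms by the second derivatives of the transition map
([hess_pullback]). *)

Set Implicit Arguments.
Unset Strict Implicit.
Unset Printing Implicit Defensive.

(** * Directional derivatives and smooth functions *)

Section MatrixValued.
Variables (R : realType) (p q : nat).

Lemma cvg_mx (T : Type) (F : set_system T) {FF : Filter F}
    (f : T -> 'M[R]_(p, q)) (a : 'M[R]_(p, q)) :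
  (forall i j, f t i j @[t --> F] --> a i j) -> f @ F --> a.
Proof.
move=> fa; apply/cvg_ballP => e e0.
suff: \forall t \near F, forall i j, ball (a i j) e (f t i j).
  by apply: filterS => t H; split.
apply: filter_forall => i; apply: filter_forall => j.
by have /cvg_ballP := fa i j; apply.
Qed.

Variable V : normedModType R.
Implicit Type f : V -> 'M[R]_(p, q).

Lemma differentiable_entry f x i j :
  differentiable f x -> differentiable (fun w => f w i j) x.
Proof.
by move=> df; exact: (differentiable_comp df (differentiable_coord _ i j)).
Qed.

Lemma differentiable_mx f x :
  (forall i j, differentiable (fun w => f w i j) x) -> differentiable f x.
Proof.
move=> df.
have -> : f = \sum_i \sum_j (fun w => f w i j *: delta_mx i j).
  apply/funext => w; rewrite {1}(matrix_sum_delta (f w)) fct_sumE.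
  by apply: eq_bigr => i _; rewrite fct_sumE.
apply: differentiable_sum => i; apply: differentiable_sum => j.
exact: differentiableZl.
Qed.

Lemma derive_entry f x v i j : differentiable f x ->
  'D_v (fun w => f w i j) x = 'D_v f x i j.
Proof. by move=> df; rewrite derive_mx ?mxE//; exact: diff_derivable. Qed.

End MatrixValued.

Section DirectionalDerivatives.
Variables (R : realType) (V W X : normedModType R).

Lemma derive_comp (f : V -> W) (h : W -> X) x v :
  differentiable f x -> differentiable h (f x) ->
  'D_v (h \o f) x = 'D_('D_v f x) h (f x).
Proof.
move=> df dh; rewrite !deriveE//; first by rewrite diff_comp.
exact: differentiable_comp.
Qed.

Lemma derive_linear (f : {linear V -> W}) x v : continuous f -> 'D_v f x = f v.
Proof.
by move=> cf; rewrite deriveE ?diff_lin//; exact: linear_differentiable.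
Qed.

Lemma derive_dirD (f : V -> W) x u v : differentiable f x ->
  'D_(u + v) f x = 'D_u f x + 'D_v f x.
Proof. by move=> df; rewrite !deriveE// linearD. Qed.

Lemma derive_dirZ (f : V -> W) x a v : differentiable f x ->
  'D_(a *: v) f x = a *: 'D_v f x.
Proof. by move=> df; rewrite !deriveE// linearZ. Qed.

Lemma derive_dir_sum (I : Type) (r : seq I) (P : pred I) (F : I -> V)
    (f : V -> W) x : differentiable f x ->
  'D_(\sum_(i <- r | P i) F i) f x = \sum_(i <- r | P i) 'D_(F i) f x.
Proof.
move=> df; rewrite deriveE// linear_sum; apply: eq_bigr => i _.
by rewrite deriveE.
Qed.

End DirectionalDerivatives.

Lemma derive_coord (R : realType) m (W : normedModType R) (f : 'rV[R]_m -> W)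
    x v : differentiable f x ->
  'D_v f x = \sum_b v 0 b *: 'D_(delta_mx 0 b) f x.
Proof.
move=> df; rewrite {1}(row_sum_delta v) derive_dir_sum//.
by apply: eq_bigr => b _; rewrite derive_dirZ.
Qed.


(** The difference vanishes near x, so it is differentiable with differential 0. *)
Lemma near_eq_differentiable (R : realType) (V W : normedModType R)
    (f h : V -> W) x :
  (\near x, f x = h x) -> differentiable f x -> differentiable h x.
Proof.
move=> fh df; rewrite -[h](subrKC f); apply: differentiableD => //.
set u := h - f.
have u0 : \near x, u x = 0.
  by apply: filterS fh => y fhy; apply/eqP; rewrite subr_eq0 fhy.
have cu : u \o shift x = cst (u x) + (\0 : {linear V -> W}) +o_ 0 id.
  apply/eqaddoP => e e0.
  have : \forall y \near (0 : V), u (y + x) = 0.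
    by move: (u0); rewrite (near_shift 0) subr0.
  apply: filterS => y uy; rewrite /= !fctE/= uy (nbhs_singleton u0).
  by rewrite !(addr0, subr0) normr0 mulr_ge0// ltW.
apply/diff_locallyP; rewrite (diff_unique _ cu)//; last exact: cst_continuous.
by split => //; exact: cst_continuous.
Qed.

Section SmoothFunctions.
Variables (R : realType) (V : normedModType R) (U : set V).
Hypothesis oU : open U.

Section General.
Variable W : normedModType R.
Implicit Types f h : V -> W.

Lemma open_near_eq f h x : (forall y, U y -> f y = h y) -> U x ->
  \forall y \near x, f y = h y.
Proof.
by move=> fh Ux; apply: filterS fh _; exact: open_nbhs_nbhs.
Qed.

(** Rules of differentiation hold only where the functions are smooth, so
derivatives can be compared on U only, which suffices as U is open. *)
Lemma Ck_eq k f h : (forall x, U x -> f x = h x) -> Ck k U f -> Ck k U h.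
Proof.
elim: k f h => [|k IH] f h fh /=.
  move=> cf x Ux; have {}cf : f @ x --> f x by exact: cf.
  have : h @ x --> f x.
    by apply: cvg_trans cf; apply: near_eq_cvg; exact: open_near_eq.
  by rewrite (fh x Ux).
move=> [df Df]; split=> [x Ux|v].
  by apply: near_eq_differentiable (df x Ux); exact: open_near_eq.
by apply: IH (Df v) => x Ux; apply: near_eq_derive; exact: open_near_eq.
Qed.

Lemma smooth_on_eq f h :
  (forall x, U x -> f x = h x) -> smooth_on U f -> smooth_on U h.
Proof. by move=> fh sf k; exact: Ck_eq (sf k). Qed.

Lemma smooth_on_differentiable f x : smooth_on U f -> U x -> differentiable f x.
Proof. by move=> /(_ 1)[df _]; exact: df. Qed.

Lemma smooth_on_continuous f x :
  smooth_on U f -> U x -> {for x, continuous f}.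
Proof. by move=> /(_ 0); apply. Qed.

Lemma smooth_on_derive f v : smooth_on U f -> smooth_on U (fun x => 'D_v f x).
Proof. by move=> sf k; have [_] := sf k.+1; exact. Qed.

Lemma smooth_on_cst (a : W) : smooth_on U (cst a).
Proof.
move=> k; elim: k a => [|k IH] a; first by move=> x _; exact: cst_continuous.
split=> [x _|v]; first exact: differentiable_cst.
have -> : (fun x => 'D_v (cst a) x) = cst 0; last exact: IH.
by apply/funext => x; rewrite derive_cst.
Qed.

Lemma Ck_add k f h : Ck k U f -> Ck k U h -> Ck k U (f + h).
Proof.
elim: k f h => [|k IH] f h /=.
  by move=> cf ch x Ux; apply: continuousD; [exact: cf|exact: ch].
move=> [df Df] [dh Dh]; split=> [x Ux|v].
  by apply: differentiableD; [exact: df|exact: dh].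
apply: Ck_eq (IH _ _ (Df v) (Dh v)) => x Ux.
by rewrite deriveD//; apply: diff_derivable; [exact: df|exact: dh].
Qed.

Lemma smooth_on_sum (I : Type) (r : seq I) (F : I -> V -> W) :
  (forall i, smooth_on U (F i)) -> smooth_on U (\sum_(i <- r) F i).
Proof.
move=> sF k; elim/big_rec: _ => [|i f _ sf]; first exact: (smooth_on_cst 0).
by apply: Ck_add => //; exact: sF.
Qed.

End General.

Lemma smooth_on_mul (a b : V -> R) :
  smooth_on U a -> smooth_on U b -> smooth_on U (a * b).
Proof.
move=> sa sb k; elim: k a b sa sb => [|k IH] a b sa sb.
  by move=> x Ux; apply: continuousM; exact: smooth_on_continuous.
split=> [x Ux|v].
  by apply: differentiableM; exact: smooth_on_differentiable.
apply: (@Ck_eq _ _ (a * (fun x => 'D_v b x) + b * (fun x => 'D_v a x))).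
  by move=> x Ux; rewrite deriveM//; apply: diff_derivable;
    exact: smooth_on_differentiable.
by apply: Ck_add; apply: IH => //; exact: smooth_on_derive.
Qed.

Lemma smooth_on_entry p q (f : V -> 'M[R]_(p, q)) i j :
  smooth_on U f -> smooth_on U (fun x => f x i j).
Proof.
move=> sf k; elim: k f sf => [|k IH] f sf.
  move=> x Ux; apply: (@continuous_comp _ _ _ f (fun M => M i j)).
    exact: smooth_on_continuous.
  exact: coord_continuous.
split=> [x Ux|v]; first exact/differentiable_entry/smooth_on_differentiable.
apply: Ck_eq (IH _ (smooth_on_derive v sf)) => x Ux.
by rewrite derive_entry//; exact: smooth_on_differentiable.
Qed.

Lemma smooth_on_mx p q (f : V -> 'M[R]_(p, q)) :
  (forall i j, smooth_on U (fun x => f x i j)) -> smooth_on U f.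
Proof.
move=> sf k; elim: k f sf => [|k IH] f sf.
  by move=> x Ux; apply: cvg_mx => i j; exact: smooth_on_continuous.
have df x : U x -> differentiable f x.
  by move=> Ux; apply: differentiable_mx => i j; exact: smooth_on_differentiable.
split=> // v; apply: IH => i j.
apply: smooth_on_eq (smooth_on_derive v (sf i j)) => x Ux.
by rewrite derive_entry//; exact: df.
Qed.

End SmoothFunctions.

Lemma smooth_on_comp_linear (R : realType) (V V' W : normedModType R)
    (U : set V) (f : V -> W) (l : {linear V' -> V}) :
  open U -> continuous l -> smooth_on U f -> smooth_on (l @^-1` U) (f \o l).
Proof.
move=> oU cl sf k; elim: k f sf => [|k IH] f sf.
  move=> x Ux; apply: continuous_comp; first exact: cl.
  exact: smooth_on_continuous sf _.
have dl x : differentiable l x by exact: linear_differentiable.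
split=> [x Ux|v].
  apply: differentiable_comp => //; exact: smooth_on_differentiable sf _.
apply: Ck_eq (IH _ (smooth_on_derive (l v) sf)).
  by apply: open_comp oU => x _; exact: cl.
move=> x Ux; rewrite derive_comp//; last exact: smooth_on_differentiable sf _.
by rewrite derive_linear.
Qed.

(** * Bilinear forms and hyperplanes *)

Section Bil.
Variables (R : realType) (m : nat).
Implicit Types (A B : 'M[R]_m) (X Y Z : 'rV[R]_m).

Lemma bilDl A X Y Z : bil A (X + Y) Z = bil A X Z + bil A Y Z.
Proof. by rewrite /bil !mulmxDl mxE. Qed.

Lemma bilDr A X Y Z : bil A X (Y + Z) = bil A X Y + bil A X Z.
Proof. by rewrite /bil linearD/= mulmxDr mxE. Qed.

Lemma bilZl A a X Y : bil A (a *: X) Y = a * bil A X Y.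
Proof. by rewrite /bil -!scalemxAl mxE. Qed.

Lemma bilZr A a X Y : bil A X (a *: Y) = a * bil A X Y.
Proof. by rewrite /bil linearZ/= -scalemxAr mxE. Qed.

Lemma bil0l A X : bil A 0 X = 0.
Proof. by rewrite -(scale0r 0) bilZl mul0r. Qed.

Lemma bil0r A X : bil A X 0 = 0.
Proof. by rewrite -(scale0r 0) bilZr mul0r. Qed.

Lemma bil_mxD A B X Y : bil (A + B) X Y = bil A X Y + bil B X Y.
Proof. by rewrite /bil mulmxDr mulmxDl mxE. Qed.

Lemma bil_mxZ a A X Y : bil (a *: A) X Y = a * bil A X Y.
Proof. by rewrite /bil -scalemxAr -scalemxAl mxE. Qed.

Lemma bil_mxN A X Y : bil (- A) X Y = - bil A X Y.
Proof. by rewrite -scaleN1r bil_mxZ mulN1r. Qed.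

Lemma bil_tr A X Y : bil A^T X Y = bil A Y X.
Proof. by rewrite /bil -[in LHS](trmxK X) -!trmx_mul mulmxA mxE. Qed.

Lemma bilE A X Y : bil A X Y = \sum_j \sum_i X 0 i * A i j * Y 0 j.
Proof.
rewrite /bil mxE; apply: eq_bigr => j _.
by rewrite !mxE mulr_suml.
Qed.

Lemma bil_delta A i j : bil A (delta_mx 0 i) (delta_mx 0 j) = A i j.
Proof. by rewrite /bil -rowE trmx_delta -colE !mxE. Qed.

Lemma bil_inj A B : (forall X Y, bil A X Y = bil B X Y) -> A = B.
Proof. by move=> AB; apply/matrixP => i j; rewrite -!bil_delta AB. Qed.

End Bil.

Definition posdef (R : realType) m (A : 'M[R]_m) :=
  forall X, X != 0 -> 0 < bil A X X.

Section PositiveDefinite.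
Variables (R : realType).

Lemma invmx_uniq m (A B : 'M[R]_m) : A *m B = 1%:M -> invmx A = B.
Proof.
by move=> AB; rewrite -[LHS]mulmx1 -AB mulKmx//; case: (mulmx1_unit AB).
Qed.

Lemma posdef_unit m (A : 'M[R]_m) : posdef A -> A \in unitmx.
Proof.
move=> pA; rewrite -row_free_unit; apply: inj_row_free => v vA.
by apply/eqP/contraT => /pA; rewrite /bil vA mul0mx mxE ltxx.
Qed.

Lemma bil_congr p m (A : 'M[R]_m) (J : 'M[R]_(p, m)) X Y :
  bil (J *m A *m J^T) X Y = bil A (X *m J) (Y *m J).
Proof. by rewrite /bil trmx_mul !mulmxA. Qed.

Lemma posdef_congr p m (A : 'M[R]_m) (E : 'M[R]_(p, m)) :
  row_free E -> posdef A -> posdef (E *m A *m E^T).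
Proof.
move=> fE pA X X0; rewrite bil_congr; apply: pA.
by rewrite mulmx_free_eq0.
Qed.

(** In the basis made of E and N, the form A is block diagonal, with blocks
E A E^T and 1; the formula inverts it blockwise. *)
Lemma hyperplane_frame_inverse m (A : 'M[R]_m) (E : 'M[R]_(m.-1, m)) N :
  posdef A -> A^T = A -> row_free E ->
  E *m A *m N^T = 0 -> bil A N N = 1 ->
  invmx A = E^T *m invmx (E *m A *m E^T) *m E + N^T *m N.
Proof.
move=> pA sA fE EN NN.
set K := RHS; set S := E *m A *m E^T in K *.
have uS : S \in unitmx by apply/posdef_unit/posdef_congr.
have NE : N *m A *m E^T = 0.
  by apply: trmx_inj; rewrite !trmx_mul trmxK sA mulmxA EN trmx0.
have NAN : N *m A *m N^T = 1%:M by rewrite [LHS]mx11_scalar -/(bil A N N) NN.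
(* N is A-orthogonal to E and not isotropic, so the m rows are independent. *)
have fQ : row_full (col_mx E N).
  have : row_free (col_mx E N).
    apply: inj_row_free => v; rewrite -[v]hsubmxK mul_row_col => vQ.
    have : (lsubmx v *m E + rsubmx v *m N) *m A *m N^T = 0 by rewrite vQ !mul0mx.
    rewrite !mulmxDl -!mulmxA (mulmxA N) NAN mulmx1 (mulmxA E) EN mulmx0 add0r.
    move=> r0; move: vQ; rewrite r0 mul0mx addr0 => /eqP.
    by rewrite mulmx_free_eq0// => /eqP ->; rewrite row_mx0.
  rewrite /row_free /row_full => /eqP ->; rewrite addn1 prednK//.
  rewrite lt0n; apply/eqP => m0; move/eqP: NN.
  rewrite bilE big1 ?(eq_sym 0) ?oner_eq0// => j _.
  by have := ltn_ord j; rewrite {2}m0.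
have AK : A *m K = 1%:M.
  apply: (row_full_inj fQ); rewrite mulmx1 mul_col_mx; congr col_mx.
    by rewrite /K mulmxDr mulmxDr !mulmxA -/S mulmxV// mul1mx EN mul0mx addr0.
  by rewrite /K mulmxDr mulmxDr !mulmxA NE !mul0mx add0r NAN mul1mx.
exact: invmx_uniq.
Qed.

(** The trace of B with respect to A over the A-orthogonal of N, in any basis E
of that hyperplane, is the full trace minus the contribution of the unit
vector N. *)
Lemma tr_hyperplane m (A B : 'M[R]_m) (E : 'M[R]_(m.-1, m)) N :
  posdef A -> A^T = A -> row_free E ->
  E *m A *m N^T = 0 -> bil A N N = 1 ->
  \tr (invmx (E *m A *m E^T) *m (E *m B *m E^T))
    = \tr (invmx A *m B) - bil B N N.
Proof.
move=> pA sA fE EN NN; rewrite (hyperplane_frame_inverse pA sA fE EN NN).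
rewrite mulmxDl mxtraceD -!mulmxA.
rewrite [\tr (E^T *m _)]mxtrace_mulC [\tr (N^T *m _)]mxtrace_mulC trace_mx11.
by rewrite /bil !mulmxA addrK.
Qed.

(** Covectors vanishing on a hyperplane are proportional; in particular dF is
proportional to the covector dual to the unit normal. *)
Lemma annihilator_hyperplane m (A : 'M[R]_m) (E : 'M[R]_(m.-1, m)) N
    (d : 'cV[R]_m) :
  posdef A -> A^T = A -> row_free E ->
  E *m A *m N^T = 0 -> bil A N N = 1 -> E *m d = 0 ->
  d = (N *m d) 0 0 *: (A *m N^T).
Proof.
move=> pA sA fE EN NN Ed.
rewrite -[LHS]mul1mx -(mulmxV (posdef_unit pA)).
rewrite (hyperplane_frame_inverse pA sA fE EN NN).
rewrite mulmxDr mulmxDl -!mulmxA Ed !mulmx0 add0r.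
by rewrite -mul_mx_scalar -mx11_scalar !mulmxA.
Qed.

(** With A the Sasakian metric, B the Hessian of F and d its differential, the
formula of [mean_curvature_level] turns this into |H| >= 1 / eps; the property
does not depend on the coordinates in which A, B and d are written. *)
Definition pinched m (eps : R) (A B : 'M[R]_m) (d : 'cV[R]_m) :=
  forall N, bil A N N = 1 ->
    1 <= \tr (invmx A *m B) - bil B N N /\ `|(N *m d) 0 0| <= eps.

Lemma pinched_congr m eps (A B J : 'M[R]_m) (d : 'cV[R]_m) :
  J \in unitmx -> A \in unitmx ->
  pinched eps A B d -> pinched eps (J *m A *m J^T) (J *m B *m J^T) (J *m d).
Proof.
move=> uJ uA pin N; rewrite !bil_congr => /pin; rewrite mulmxA.
congr (_ <= _ - _ /\ _).
have uJT : J^T \in unitmx by rewrite unitmx_tr.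
have -> : invmx (J *m A *m J^T) = invmx J^T *m invmx A *m invmx J.
  by apply: invmx_uniq; rewrite -!mulmxA mulKVmx// mulKVmx// mulmxV.
rewrite -!mulmxA mulKmx// [in RHS]mxtrace_mulC -!mulmxA mulmxV//.
by rewrite mulmx1.
Qed.
End PositiveDefinite.

(** * Limits of matrices *)

Section MatrixLimits.
Variables (R : realType) (T : Type) (F : set_system T).
Context {FF : Filter F}.

Lemma cvg_sumr I (r : seq I) (f : I -> T -> R) (a : I -> R) :
  (forall i, f i t @[t --> F] --> a i) ->
  \sum_(i <- r) f i t @[t --> F] --> \sum_(i <- r) a i.
Proof. by move=> fa; apply: cvg_big => //; exact: add_continuous. Qed.

Lemma cvg_prodr I (r : seq I) (f : I -> T -> R) (a : I -> R) :
  (forall i, f i t @[t --> F] --> a i) ->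
  \prod_(i <- r) f i t @[t --> F] --> \prod_(i <- r) a i.
Proof. by move=> fa; apply: cvg_big => //; exact: mul_continuous. Qed.

Lemma cvg_entry p q (f : T -> 'M[R]_(p, q)) (a : 'M[R]_(p, q)) i j :
  f @ F --> a -> f t i j @[t --> F] --> a i j.
Proof.
by move=> fa; exact: (cvg_comp _ _ fa (@coord_continuous _ _ _ i j a)).
Qed.

Lemma cvg_mulmx p q s (f : T -> 'M[R]_(p, q)) (h : T -> 'M[R]_(q, s))
    (a : 'M[R]_(p, q)) (b : 'M[R]_(q, s)) :
  f @ F --> a -> h @ F --> b -> f t *m h t @[t --> F] --> a *m b.
Proof.
move=> fa hb; apply: cvg_mx => i j.
under eq_cvg do rewrite mxE.
by rewrite mxE; apply: cvg_sumr => k; apply: cvgM; exact: cvg_entry.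
Qed.

Lemma cvg_trmx p q (f : T -> 'M[R]_(p, q)) (a : 'M[R]_(p, q)) :
  f @ F --> a -> (f t)^T @[t --> F] --> a^T.
Proof.
move=> fa; apply: cvg_mx => i j; under eq_cvg do rewrite mxE.
by rewrite mxE; exact: cvg_entry.
Qed.

Lemma cvg_bil m (A : T -> 'M[R]_m) (u v : T -> 'rV[R]_m)
    (A0 : 'M[R]_m) (u0 v0 : 'rV[R]_m) :
  A @ F --> A0 -> u @ F --> u0 -> v @ F --> v0 ->
  bil (A t) (u t) (v t) @[t --> F] --> bil A0 u0 v0.
Proof.
move=> AA uu vv; apply: (@cvg_entry _ _ (fun t => u t *m A t *m (v t)^T)).
by apply: cvg_mulmx; [exact: cvg_mulmx|exact: cvg_trmx].
Qed.

Lemma cvg_mxtrace m (A : T -> 'M[R]_m) (A0 : 'M[R]_m) :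
  A @ F --> A0 -> \tr (A t) @[t --> F] --> \tr A0.
Proof. by move=> AA; apply: cvg_sumr => i; exact: cvg_entry. Qed.

Lemma cvg_det m (A : T -> 'M[R]_m) (A0 : 'M[R]_m) :
  A @ F --> A0 -> \det (A t) @[t --> F] --> \det A0.
Proof.
move=> AA; apply: cvg_sumr => s; apply: cvgM; first exact: cvg_cst.
by apply: cvg_prodr => i; exact: cvg_entry.
Qed.

Lemma cvg_invmx m (A : T -> 'M[R]_m) (A0 : 'M[R]_m) : A0 \in unitmx ->
  A @ F --> A0 -> invmx (A t) @[t --> F] --> invmx A0.
Proof.
move=> uA0 AA; have d0 : \det A0 != 0 by rewrite -unitfE -unitmxE.
have dA := cvg_det AA.
have near_unit : \forall t \near F, A t \in unitmx.
  have : \forall t \near F, \det (A t) != 0 by exact: cvgr_neq0 dA d0.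
  by apply: filterS => t; rewrite unitmxE unitfE.
have : (\det (A t))^-1 *: \adj (A t) @[t --> F] --> invmx A0.
  rewrite /invmx uA0; apply: cvg_mx => i j.
  under eq_cvg do rewrite !mxE.
  rewrite !mxE; apply: cvgM; first exact: cvgV.
  apply: cvgM; first exact: cvg_cst.
  apply: cvg_det; apply: cvg_mx => k l.
  under eq_cvg do rewrite !mxE.
  by rewrite !mxE; exact: cvg_entry.
apply: cvg_trans; apply: near_eq_cvg.
by apply: filterS near_unit => t uA; rewrite /invmx uA.
Qed.

End MatrixLimits.

(** The form is positive on the unit sphere, which is compact, so it remains so
uniformly under small perturbations. *)
Lemma near_posdef (R : realType) (T : Type) (F : set_system T) {FF : Filter F}
    m (A : T -> 'M[R]_m) (A0 : 'M[R]_m) :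
  A @ F --> A0 -> posdef A0 -> \forall t \near F, posdef (A t).
Proof.
move=> AA pA0.
have cK : compact [set v : 'rV[R]_m | `|v| = 1].
  apply: bounded_closed_compact.
    exists 1; split; first exact: num_real.
    by move=> x x1 v /= ->; exact: ltW.
  apply: (@preimage_closed _ _ (fun v : 'rV[R]_m => `|v|) [set x | x = 1]).
    by move=> v _; exact: norm_continuous.
  exact: closed_eq.
have {cK} : \forall t \near F,
    [set v : 'rV[R]_m | `|v| = 1] `<=` [set v | 0 < bil (A t) v v].
  move/compact_near_coveringP: cK; apply => v v1.
  have v0 : v != 0 by rewrite -normr_gt0 v1.
  have c : bil (A p.2) p.1 p.1 @[p --> filter_prod (nbhs v) F] --> bil A0 v v.
    apply: (@cvg_bil _ _ _ _ _ (fun p => A p.2) fst fst);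
      [|exact: cvg_fst|exact: cvg_fst].
    exact: (cvg_comp _ _ cvg_snd AA).
  by apply: (cvgr_gt _ c); exact: pA0.
(* Quadratic forms scale by a positive factor along rays. *)
apply: filterS => t pt X X0.
have nX : 0 < `|X| by rewrite normr_gt0.
have := pt (`|X|^-1 *: X); rewrite /= bilZl bilZr mulrA.
rewrite pmulr_rgt0 ?mulr_gt0 ?invr_gt0//; apply.
by rewrite normrZ normfV normr_id mulVf// gt_eqF.
Qed.

(** * Hessians and mean curvature of level sets *)

Lemma derive_sum_mul (R : realType) (V : normedModType R) m
    (a b : 'I_m -> V -> R) x v :
  (forall i, differentiable (a i) x) -> (forall i, differentiable (b i) x) ->
  'D_v (fun w => \sum_i a i w * b i w) x
    = \sum_i (a i x * 'D_v (b i) x + b i x * 'D_v (a i) x).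
Proof.
move=> da db.
have -> : (fun w => \sum_i a i w * b i w) = \sum_i (a i * b i).
  by apply/funext => w; rewrite fct_sumE.
have da' i : derivable (a i) x v by exact: diff_derivable.
have db' i : derivable (b i) x v by exact: diff_derivable.
rewrite derive_sum; first by apply: eq_bigr => i _; rewrite deriveM.
by move=> i; exact: derivableM.
Qed.

Section Hessian.
Variables (R : realType) (m : nat) (U : set 'rV[R]_m) (F : 'rV[R]_m -> R).
Hypotheses (oU : open U) (sF : smooth_on U F).

Let dF y : U y -> differentiable F y.
Proof. exact: smooth_on_differentiable. Qed.

Let dDF v y : U y -> differentiable (fun w => 'D_v F w) y.
Proof. exact/smooth_on_differentiable/smooth_on_derive. Qed.

Lemma derive_derive_coord u v y : U y ->
  'D_u (fun w => 'D_v F w) y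
    = \sum_b v 0 b * 'D_u (fun w => 'D_(delta_mx 0 b) F w) y.
Proof.
move=> Uy.
rewrite (near_eq_derive _ (g := fun w => \sum_b v 0 b * 'D_(delta_mx 0 b) F w)).
  rewrite (derive_sum_mul (a := fun b => cst (v 0 b))) => [|b|b].
  - by apply: eq_bigr => b _; rewrite derive_cst mulr0 addr0.
  - exact: differentiable_cst.
  - exact: dDF.
by apply: (open_near_eq oU) Uy => w Uw; rewrite derive_coord//; exact: dF.
Qed.

(** The chain rule for w |-> dF_(c w)(e w).  With c a curve and e a field along
it, this differentiates dF(B) along a level set; with c a transition map and
e = dc(Y), it is the transformation of second derivatives. *)
Lemma derive_along (V : normedModType R) (c e : V -> 'rV[R]_m) x v :
  U (c x) -> differentiable c x -> differentiable e x ->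
  'D_v (fun w => 'D_(e w) F (c w)) x
    = 'D_('D_v e x) F (c x) + 'D_('D_v c x) (fun y => 'D_(e x) F y) (c x).
Proof.
move=> Ux dc de.
rewrite (near_eq_derive _
  (g := fun w => \sum_b e w 0 b * 'D_(delta_mx 0 b) F (c w))).
  rewrite (derive_sum_mul (a := fun b w => e w 0 b)
             (b := fun b w => 'D_(delta_mx 0 b) F (c w))) => [|b|b].
  - rewrite derive_derive_coord// [X in _ = X + _]derive_coord; last exact: dF.
    rewrite -big_split; apply: eq_bigr => b _ /=.
    rewrite addrC derive_entry//.
    rewrite -(derive_comp v dc (dDF (delta_mx 0 b) Ux)).
    by congr (_ + _); exact: mulrC.
  - exact: differentiable_entry.
  - exact: (differentiable_comp dc (dDF _ Ux)).
have : \forall w \near x, U (c w).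
  apply: (differentiable_continuous dc).
  exact: open_nbhs_nbhs.
by apply: filterS => w Uw; rewrite derive_coord//; exact: dF.
Qed.

Definition grad z : 'cV[R]_m := \col_a 'D_(delta_mx 0 a) F z.

(** The covariant Hessian X (Y F) - (nabla_X Y) F on constant fields, where
[Gz] gives the connection coefficients at z. *)
Definition hess (Gz : 'I_m -> 'M[R]_m) z : 'M[R]_m :=
  \matrix_(a, b) ('D_(delta_mx 0 a) (fun w => 'D_(delta_mx 0 b) F w) z
                  - 'D_(christoffel Gz (delta_mx 0 a) (delta_mx 0 b)) F z).

Lemma mul_grad X z : U z -> (X *m grad z) 0 0 = 'D_X F z.
Proof.
move=> Uz; rewrite derive_coord; last exact: dF.
by rewrite mxE; apply: eq_bigr => b _; rewrite mxE.
Qed.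

Lemma christoffel_coord (Gz : 'I_m -> 'M[R]_m) X Y :
  christoffel Gz X Y = \sum_j \sum_i (X 0 i * Y 0 j)
                         *: christoffel Gz (delta_mx 0 i) (delta_mx 0 j).
Proof.
apply/rowP => k; rewrite mxE bilE summxE; apply: eq_bigr => j _.
by rewrite summxE; apply: eq_bigr => i _; rewrite !mxE bil_delta mulrAC.
Qed.

Lemma bil_hess Gz z X Y : U z ->
  bil (hess Gz z) X Y
    = 'D_X (fun w => 'D_Y F w) z - 'D_(christoffel Gz X Y) F z.
Proof.
move=> Uz; rewrite bilE derive_derive_coord// christoffel_coord.
rewrite derive_dir_sum; last exact: dF.
rewrite -sumrB; apply: eq_bigr => j _.
rewrite derive_coord; last exact: dDF.
rewrite derive_dir_sum; last exact: dF.
rewrite mulr_sumr -sumrB; apply: eq_bigr => i _.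
rewrite derive_dirZ; last exact: dF.
rewrite mxE mulrAC mulrBr; congr (_ - _).
by rewrite /GRing.scale/= mulrCA mulrA.
Qed.

End Hessian.

Section LevelSets.
Variables (R : realType) (m : nat) (U : set 'rV[R]_m) (F : 'rV[R]_m -> R).
Hypotheses (oU : open U) (sF : smooth_on U F).
Variables (S : set 'rV[R]_m) (a : R).
Hypotheses (SU : S `<=` U) (SF : forall w, S w -> F w = a).

Lemma smooth_near_differentiable (V W : normedModType R) (f : V -> W) x :
  smooth_near x f -> differentiable f x.
Proof. by move=> [W' [_ W'x] sf]; exact: smooth_on_differentiable sf _. Qed.

(** The function is constant along any curve drawn on the level set. *)
Lemma derive_tangent z X : S z -> tangent_at S z X -> 'D_X F z = 0.
Proof.
move=> Sz [c [sc Sc c0 cX]].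
have dc := smooth_near_differentiable sc.
have Dc : 'D_(1 : R^o) c 0 = X by rewrite -cX /velocity derive1E.
have := derive_comp (h := F) (1 : R^o) dc; rewrite c0 Dc => <-.
  rewrite (near_eq_derive _ (g := cst a)) ?derive_cst//.
  by apply: filterS Sc => t; exact: SF.
by apply: smooth_on_differentiable sF _; exact: SU.
Qed.

(** Differentiate dF(B) = 0 along a curve of the level set with velocity X. *)
Lemma derive_tangent_field z X B : S z -> tangent_at S z X ->
  tangent_field S z B ->
  'D_('D_X B z) F z = - 'D_X (fun w => 'D_(B z) F w) z.
Proof.
move=> Sz [c [sc Sc c0 cX]] [sB tB].
have dc := smooth_near_differentiable sc.
have dB := smooth_near_differentiable sB.
have Dc : 'D_(1 : R^o) c 0 = X by rewrite -cX /velocity derive1E.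
have Uc : U (c 0) by rewrite c0; exact: SU.
have dBz : differentiable B (c 0) by rewrite c0.
have dBc : differentiable (B \o c) (0 : R^o) := differentiable_comp dc dBz.
have DBc : 'D_(1 : R^o) (B \o c) 0 = 'D_X B z.
  by rewrite -Dc -[in RHS]c0; exact: derive_comp dc dBz.
apply/eqP; rewrite -addr_eq0; apply/eqP.
have := derive_along oU sF (1 : R^o) Uc dc dBc.
rewrite DBc Dc /= c0 => <-.
rewrite (near_eq_derive _ (g := cst 0)) ?derive_cst//.
have : \forall t \near (0 : R^o), S (c t) -> tangent_at S (c t) (B (c t)).
  have cc : c @ (0 : R^o) --> z by rewrite -c0; exact: differentiable_continuous.
  exact: cc _ tB.
move=> tc; apply: filterS2 Sc tc => t Sct /(_ Sct); exact: derive_tangent.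
Qed.

(** Writing dF = c Gt(N, .), the values c h(E_k, E_l) are the dF(nabla_(E_k) B_l),
that is, - Hess F(E_k, E_l) by [derive_tangent_field].  The rows of E
span the whole orthogonal of N, by dimension. *)
Lemma mean_curvature_level (g : 'rV[R]_m -> 'M[R]_m) G z N H :
  S z -> posdef (g z) -> (g z)^T = g z ->
  unit_normal g S z N -> mean_curvature g G S z N H ->
  (N *m grad F z) 0 0 * H
    = bil (hess F (G z) z) N N - \tr (invmx (g z) *m hess F (G z) z).
Proof.
move=> Sz pg sg [NN Nt] [E [B [fE tE tB ->]]].
have Uz := SU Sz.
have EN : E *m g z *m N^T = 0.
  apply/row_matrixP => k; rewrite row0 !row_mul; apply/rowP => j.
  by rewrite ord1 [RHS]mxE -/(bil _ _ _) -sg bil_tr Nt.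
have Ed : E *m grad F z = 0.
  apply/row_matrixP => k; rewrite row0 row_mul; apply/rowP => j.
  by rewrite ord1 [RHS]mxE (mul_grad sF)// derive_tangent.
have := annihilator_hyperplane pg sg fE EN NN Ed.
move: ((N *m grad F z) 0 0) => c dE.
rewrite -opprB -(tr_hyperplane _ pg sg fE EN NN) -mulN1r -!mxtraceZ.
rewrite [c *: _]scalemxAr [-1 *: _]scalemxAr scaleN1r.
congr (\tr (_ *m _)); apply/matrixP => k l.
have sff X : c * bil (g z) X N = 'D_X F z.
  by rewrite -(mul_grad sF)// dE -scalemxAr mxE mulmxA.
rewrite mxE [X in _ * X]mxE sff /cov_deriv derive_dirD; last first.
  exact: smooth_on_differentiable sF _.
have [tBl Bl] := tB l.
rewrite derive_tangent_field// Bl.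
rewrite mxE -(bil_delta (E *m _ *m _)) bil_congr -!rowE.
by rewrite (bil_hess oU sF)// opprB addrC.
Qed.

End LevelSets.

(** * Bilinear expressions, Hessians and pinching in the limit *)

Lemma smooth_on_linear (R : realType) (V W : normedModType R) (U : set V)
    (f : {linear V -> W}) : open U -> continuous f -> smooth_on U f.
Proof.
move=> oU cf [|k]; first by move=> x _; exact: cf.
split=> [x _|v]; first exact: linear_differentiable.
have -> : (fun x => 'D_v f x) = cst (f v).
  by apply/funext => x; exact: derive_linear.
exact: smooth_on_cst.
Qed.

Section BilinearCalculus.
Variables (R : realType) (V : normedModType R) (m : nat).
Variables (Q : V -> 'M[R]_m) (u w : V -> 'rV[R]_m).

Lemma smooth_on_bil (U : set V) : open U ->
  smooth_on U Q -> smooth_on U u -> smooth_on U w ->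
  smooth_on U (fun x => bil (Q x) (u x) (w x)).
Proof.
move=> oU sQ su sw.
apply: (smooth_on_eq oU (f := \sum_j \sum_i
    ((fun x => u x 0 i) * (fun x => Q x i j) * (fun x => w x 0 j)))).
  by move=> x _; rewrite bilE fct_sumE; apply: eq_bigr => j _; rewrite fct_sumE.
apply: smooth_on_sum => // j; apply: smooth_on_sum => // i.
by apply: smooth_on_mul => //; [apply: smooth_on_mul => //|];
  exact: smooth_on_entry.
Qed.

Lemma derive_bil x v :
  differentiable Q x -> differentiable u x -> differentiable w x ->
  'D_v (fun x => bil (Q x) (u x) (w x)) x
    = bil ('D_v Q x) (u x) (w x) + bil (Q x) ('D_v u x) (w x)
      + bil (Q x) (u x) ('D_v w x).
Proof.
move=> dQ du dw.
pose a j x := \sum_i u x 0 i * Q x i j.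
have da j : differentiable (a j) x.
  have -> : a j = \sum_i ((fun x => u x 0 i) * (fun x => Q x i j)).
    by apply/funext => y; rewrite fct_sumE.
  by apply: differentiable_sum => i; apply: differentiableM;
    exact: differentiable_entry.
have -> : (fun x => bil (Q x) (u x) (w x)) = (fun x => \sum_j a j x * w x 0 j).
  by apply/funext => y; rewrite bilE; apply: eq_bigr => j _; rewrite mulr_suml.
rewrite (derive_sum_mul v (b := fun j x => w x 0 j)) => [|//|j]; last first.
  exact: differentiable_entry.
rewrite !bilE -!big_split; apply: eq_bigr => j _ /=.
rewrite derive_entry// addrC; congr (_ + _); first by rewrite mulr_suml.
rewrite /a (derive_sum_mul (a := fun i x => u x 0 i) (b := fun i x => Q x i j)).
- rewrite -big_split/= mulr_sumr.
  apply: eq_bigr => i _ /=; rewrite !derive_entry//.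
  by rewrite mulrC mulrDl [Q x i j * _]mulrC.
- by move=> i; exact: differentiable_entry.
- by move=> i; exact: differentiable_entry.
Qed.

End BilinearCalculus.

Lemma cvg_hess (R : realType) m (U : set 'rV[R]_m) (F : 'rV[R]_m -> R)
    (G : 'rV[R]_m -> 'I_m -> 'M[R]_m) z :
  open U -> smooth_on U F -> U z -> (forall k, {for z, continuous (G ^~ k)}) ->
  hess F (G w) w @[w --> z] --> hess F (G z) z.
Proof.
move=> oU sF Uz cG; apply: (@cvg_mx _ _ _ _ (nbhs z)) => a b.
under eq_cvg do rewrite mxE.
rewrite mxE; apply: cvgB.
  exact: (smooth_on_continuous (smooth_on_derive _ (smooth_on_derive _ sF)) Uz).
set X := delta_mx 0 a; set Y := delta_mx 0 b.
rewrite derive_coord; last exact: smooth_on_differentiable sF _.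
have : \sum_k bil (G w k) X Y * 'D_(delta_mx 0 k) F w @[w --> z]
    --> \sum_k christoffel (G z) X Y 0 k *: 'D_(delta_mx 0 k) F z.
  apply: (@cvg_sumr _ _ (nbhs z)) => k; apply: cvgM; last first.
    exact: (smooth_on_continuous (smooth_on_derive _ sF) Uz).
  by rewrite mxE; apply: (@cvg_bil _ _ (nbhs z));
    [exact: cG|exact: cvg_cst|exact: cvg_cst].
apply: cvg_trans; apply: near_eq_cvg.
apply: (open_near_eq oU) Uz => w Uw.
rewrite derive_coord; last exact: smooth_on_differentiable sF _.
by apply: eq_bigr => k _; rewrite mxE.
Qed.

(** The conditions on the limits are open: the Hessian stays below (5/2) A, and
the trace stays above 7/2 since its limit is at least 4, which leaves
7/2 - 5/2 = 1; the differential tends to 0, so its square becomes smaller than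
eps^2 A.  The constant 5/2 leaves room above 2, the value of the Hessian on
vertical unit vectors at the zero section. *)
Lemma near_pinched (R : realType) (T : Type) (F : set_system T) {FF : Filter F}
    m (eps : R) (A B : T -> 'M[R]_m) (d : T -> 'cV[R]_m) A0 B0 :
  A @ F --> (A0 : 'M[R]_m) -> B @ F --> (B0 : 'M[R]_m) ->
  d @ F --> (0 : 'cV[R]_m) -> 0 < eps ->
  posdef A0 -> posdef ((5 / 2) *: A0 - B0) -> 4 <= \tr (invmx A0 *m B0) ->
  \forall t \near F, pinched eps (A t) (B t) (d t).
Proof.
move=> AA BB dd eps0 pA pAB trAB.
have pt : \forall t \near F, posdef ((5 / 2) *: A t - B t).
  apply: near_posdef pAB; apply: cvgB BB.
  apply: cvgZ AA; exact: cvg_cst.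
have pd : \forall t \near F, posdef (eps ^+ 2 *: A t - d t *m (d t)^T).
  apply: (@near_posdef _ _ _ _ _ _ (eps ^+ 2 *: A0 - 0 *m 0^T)).
    apply: cvgB; first by apply: cvgZ AA; exact: cvg_cst.
    exact: cvg_mulmx dd (cvg_trmx dd).
  by move=> X X0; rewrite mul0mx subr0 bil_mxZ mulr_gt0 ?exprn_gt0//; exact: pA.
have ptr : \forall t \near F, 7 / 2 < \tr (invmx (A t) *m B t).
  apply: (cvgr_gt (\tr (invmx A0 *m B0))).
    apply: cvg_mxtrace; apply: cvg_mulmx BB; apply: cvg_invmx AA.
    exact: posdef_unit.
  apply: lt_le_trans trAB; lra.
near=> t => N NN.
have N0 : N != 0.
  by apply: contra_eq_neq NN => ->; rewrite bil0l eq_sym oner_neq0.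
split.
  have : 0 < bil ((5 / 2) *: A t - B t) N N by apply: (near pt t).
  rewrite bil_mxD bil_mxN bil_mxZ NN mulr1 => hN.
  have : 7 / 2 < \tr (invmx (A t) *m B t) by near: t.
  by lra.
have : 0 < bil (eps ^+ 2 *: A t - d t *m (d t)^T) N N by apply: (near pd t).
rewrite bil_mxD bil_mxN bil_mxZ NN mulr1 subr_gt0.
have -> : bil (d t *m (d t)^T) N N = ((N *m d t) 0 0) ^+ 2.
  rewrite /bil mulmxA -mulmxA -trmx_mul [N *m d t]mx11_scalar.
  by rewrite tr_scalar_mx -scalar_mxM !mxE eqxx mulr1n.
rewrite -[X in X < _]real_normK ?num_real// => /ltW.
by rewrite ler_pXn2r ?nnegrE// ltW.
Unshelve. all: by end_near. Qed.

(** * The squared norm and the Sasakian metric at the zero section *)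

Section SquaredNorm.
Variables (R : realType) (n : nat) (U : set 'rV[R]_n) (g : 'rV[R]_n -> 'M[R]_n).
Hypotheses (oU : open U) (sg : smooth_on U g).
Implicit Types (z A B : 'rV[R]_(n + n)) (x : 'rV[R]_n).

(** The function F, in the chart of the tangent bundle induced by a chart. *)
Definition sqnorm z : R := bil (g (lsubmx z)) (rsubmx z) (rsubmx z).

(** The domain of the induced chart over a chart domain U. *)
Definition tangent_dom : set 'rV[R]_(n + n) := [set z | U (lsubmx z)].

Lemma open_tangent_dom : open tangent_dom.
Proof. by apply: open_comp oU => z _; exact: continuous_lsubmx. Qed.

Let sgl : smooth_on tangent_dom (g \o lsubmx).
Proof. exact: smooth_on_comp_linear oU (@continuous_lsubmx _ 1 n n) sg. Qed.

Let sr : smooth_on tangent_dom (rsubmx : 'rV[R]_(n + n) -> 'rV[R]_n).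
Proof. exact: smooth_on_linear open_tangent_dom (@continuous_rsubmx _ 1 n n). Qed.

Lemma smooth_on_sqnorm : smooth_on tangent_dom sqnorm.
Proof. exact: smooth_on_bil open_tangent_dom sgl sr sr. Qed.

Lemma derive_rsubmx z A :
  'D_A (rsubmx : 'rV[R]_(n + n) -> 'rV[R]_n) z = rsubmx A.
Proof. exact: derive_linear (@continuous_rsubmx _ 1 n n). Qed.

Lemma derive_sqnorm z A : tangent_dom z ->
  'D_A sqnorm z
    = bil ('D_A (g \o lsubmx) z) (rsubmx z) (rsubmx z)
      + bil (g (lsubmx z)) (rsubmx A) (rsubmx z)
      + bil (g (lsubmx z)) (rsubmx z) (rsubmx A).
Proof.
move=> Uz; rewrite (derive_bil (Q := g \o lsubmx)) ?derive_rsubmx//.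
  exact: smooth_on_differentiable sgl _.
exact: differentiable_rsubmx.
exact: differentiable_rsubmx.
Qed.

Section ZeroSection.
Variable x : 'rV[R]_n.
Hypothesis Ux : U x.
Let z : 'rV[R]_(n + n) := row_mx x 0.

Let lz : lsubmx z = x. Proof. exact: row_mxKl. Qed.
Let rz : rsubmx z = 0. Proof. exact: row_mxKr. Qed.
Let Uz : tangent_dom z. Proof. by rewrite /tangent_dom/= lz. Qed.

Lemma derive_sqnorm0 A : 'D_A sqnorm z = 0.
Proof. by rewrite derive_sqnorm// rz bil0l bil0l bil0r !addr0. Qed.

Lemma grad_sqnorm0 : grad sqnorm z = 0.
Proof. by apply/colP => a; rewrite !mxE derive_sqnorm0. Qed.

(** At a zero vector, the only terms of the second derivative of g(y, y) that
survive are those where both derivatives fall on y. *)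
Lemma hess_sqnorm0 (G : 'I_(n + n) -> 'M[R]_(n + n)) A B :
  bil (hess sqnorm G z) A B
    = bil (g x) (rsubmx B) (rsubmx A) + bil (g x) (rsubmx A) (rsubmx B).
Proof.
rewrite (bil_hess open_tangent_dom smooth_on_sqnorm)// derive_sqnorm0 subr0.
have dr y : differentiable (rsubmx : 'rV[R]_(n + n) -> 'rV[R]_n) y.
  exact: differentiable_rsubmx.
have dg : differentiable (g \o lsubmx) z := smooth_on_differentiable sgl Uz.
have dDg : differentiable (fun w => 'D_B (g \o lsubmx) w) z.
  exact: smooth_on_differentiable (smooth_on_derive B sgl) Uz.
pose f1 w := bil ('D_B (g \o lsubmx) w) (rsubmx w) (rsubmx w).
pose f2 w := bil ((g \o lsubmx) w) (cst (rsubmx B) w) (rsubmx w).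
pose f3 w := bil ((g \o lsubmx) w) (rsubmx w) (cst (rsubmx B) w).
have sf1 : smooth_on tangent_dom f1.
  exact: smooth_on_bil open_tangent_dom (smooth_on_derive B sgl) sr sr.
have sf2 : smooth_on tangent_dom f2.
  exact: smooth_on_bil open_tangent_dom sgl (smooth_on_cst _ _) sr.
have sf3 : smooth_on tangent_dom f3.
  exact: smooth_on_bil open_tangent_dom sgl sr (smooth_on_cst _ _).
have df f : smooth_on tangent_dom f -> derivable f z A.
  by move=> sf; apply: diff_derivable; exact: smooth_on_differentiable sf Uz.
rewrite (near_eq_derive _ (g := f1 + f2 + f3)); last first.
  by apply: (open_near_eq open_tangent_dom) Uz => w; exact: derive_sqnorm.
rewrite !deriveD//; [|exact: df..|by apply: derivableD; exact: df|exact: df].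
rewrite /f1 /f2 /f3 !derive_bil// ?derive_rsubmx ?derive_cst;
  try exact: differentiable_cst.
by rewrite /= lz rz !(bil0l, bil0r) !(addr0, add0r).
Qed.

End ZeroSection.
End SquaredNorm.

Section SasakiZeroSection.
Variables (R : realType) (n : nat) (C : charts R n).
Variables (g : metric_field C) (G : christoffel_field C).
Variable Gt : metric_field (tangent_charts C).
Hypothesis sG : sasakian g G Gt.
Variables (i : chart_index C) (x : 'rV[R]_n).
Hypothesis Ux : chart_image C i x.
Let z : 'rV[R]_(n + n) := row_mx x 0.

Lemma vertical_liftE (w : 'rV[R]_(n + n)) X : vertical_lift w X = row_mx 0 X.
Proof.
rewrite /vertical_lift /velocity derive1E.
have -> : (fun t : R => row_mx (lsubmx w) (rsubmx w + t *: X))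
    = cst w + ( *:%R^~ (row_mx 0 X)).
  apply/funext => t; rewrite -[in RHS](hsubmxK w) fctE /=.
  by rewrite scale_row_mx add_row_mx scaler0 addr0.
rewrite deriveD ?derive_cst ?add0r; last 2 first.
- exact: derivable_cst.
- by apply: diff_derivable; exact: ex_diff.
by rewrite deriveE; [rewrite diff_val scale1r|exact: ex_diff].
Qed.

(** A parallel vector field that vanishes at time 0 has zero derivative at
time 0, by the equation of parallel transport. *)
Lemma horizontal_lift0 X : horizontal_lift G i z X (row_mx X 0).
Proof.
move=> c [sc _ _ pc [c0 cX]].
have dc := smooth_near_differentiable sc.
have Dc (l : {linear 'rV[R]_(n + n) -> 'rV[R]_n}) : continuous l ->
    velocity (fun t => l (c t)) 0 = l (velocity c 0).
  move=> cl; rewrite /velocity !derive1E.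
  rewrite (derive_comp (h := l))// ?derive_linear//.
  exact: linear_differentiable.
have := nbhs_singleton pc.
rewrite /cov_deriv_along c0 Dc; last exact: continuous_rsubmx.
have -> Y : christoffel (G i (lsubmx z)) Y (rsubmx z) = 0.
  by apply/rowP => k; rewrite !mxE row_mxKr bil0r.
rewrite addr0 => r0; rewrite -[LHS]hsubmxK r0; congr row_mx.
by rewrite -cX Dc//; exact: continuous_lsubmx.
Qed.

(** Every vector splits as the sum of a horizontal and a vertical lift. *)
Lemma sasakian0 A B : bil (Gt i z) A B
  = bil (g i x) (lsubmx A) (lsubmx B) + bil (g i x) (rsubmx A) (rsubmx B).
Proof.
have Uz : chart_image (tangent_charts C) i z by rewrite /= row_mxKl.
have [rGt Gts] := sG; have [_ sGt _ _] := rGt.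
have split_row (Y : 'rV[R]_(n + n)) :
    Y = row_mx (lsubmx Y) 0 + vertical_lift z (rsubmx Y).
  by rewrite vertical_liftE add_row_mx addr0 add0r hsubmxK.
have hh X Y : bil (Gt i z) (row_mx X 0) (row_mx Y 0) = bil (g i x) X Y.
  have [_ + _] := Gts i z X Y Uz; rewrite row_mxKl; apply;
  exact: horizontal_lift0.
have vv X Y : bil (Gt i z) (vertical_lift z X) (vertical_lift z Y) = bil (g i x) X Y.
  by have [+ _ _] := Gts i z X Y Uz; rewrite row_mxKl.
have vh X Y : bil (Gt i z) (vertical_lift z X) (row_mx Y 0) = 0.
  have [_ _] := Gts i z X Y Uz; apply; exact: horizontal_lift0.
have hv X Y : bil (Gt i z) (row_mx X 0) (vertical_lift z Y) = 0.
  by rewrite -(sGt i z Uz) bil_tr vh.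
rewrite [in LHS](split_row A) [in LHS](split_row B) bilDl !bilDr.
by rewrite hh hv vh vv addr0 add0r.
Qed.

End SasakiZeroSection.

(** * Pinching near the zero section *)

Section NearZeroSection.
Variables (R : realType) (n : nat) (C : charts R n).
Variables (g : metric_field C) (G : christoffel_field C).
Variables (Gt : metric_field (tangent_charts C)).
Variable D : christoffel_field (tangent_charts C).

Definition sqnorm_hess i z := hess (sqnorm (g i)) (D i z) z.

Definition pinched_at (eps : R) i z :=
  pinched eps (Gt i z) (sqnorm_hess i z) (grad (sqnorm (g i)) z).

Hypotheses (rg : riemannian g) (sG : sasakian g G Gt) (cD : connection D).
Variables (i : chart_index C) (x : 'rV[R]_n) (eps : R).
Hypotheses (n2 : (1 < n)%N) (oU : open (chart_image C i)).
Hypotheses (Ux : chart_image C i x) (eps0 : 0 < eps).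
Let z : 'rV[R]_(n + n) := row_mx x 0.

Let Uz : tangent_dom (chart_image C i) z.
Proof. by rewrite /tangent_dom/= row_mxKl. Qed.

(** In matrix form: with respect to Gt, the Hessian at a zero vector is twice the
vertical projection, which gives its trace 2n. *)
Lemma sqnorm_hess0 : sqnorm_hess i z = Gt i z *m block_mx 0 0 0 2%:M.
Proof.
have [sg symg _ _] := rg.
apply: bil_inj => A B; rewrite (hess_sqnorm0 oU (sg i) Ux).
have -> : bil (Gt i z *m block_mx 0 0 0 2%:M) A B
    = bil (Gt i z) A (row_mx 0 (2 *: rsubmx B)).
  rewrite /bil -{1}[B]hsubmxK tr_row_mx -!mulmxA mul_block_col tr_row_mx.
  by rewrite !mul0mx !add0r mul_scalar_mx linearZ/= trmx0.
rewrite (sasakian0 sG Ux) row_mxKl row_mxKr bil0r add0r bilZr.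
by rewrite -[in X in X + _](symg i x Ux) bil_tr mulr_natl mulr2n.
Qed.

(** The limit form (5/2) Gt - Hess F is (5/2) g on horizontal vectors and
(1/2) g on vertical ones. *)
Lemma near_zero_section : \forall w \near z, pinched_at eps i w.
Proof.
have [sg symg pg _] := rg; have [[sGt _ pGt _] _] := sG.
have oO := open_tangent_dom oU.
have sF := smooth_on_sqnorm oU (sg i).
apply: (@near_pinched _ _ (nbhs z) _ _ _ _ _ _ (Gt i z) (sqnorm_hess i z)) => //.
- exact: (smooth_on_continuous (sGt i) Uz).
- apply: (cvg_hess oO sF Uz) => k.
  exact: (smooth_on_continuous (cD.1 i k) Uz).
- rewrite -(grad_sqnorm0 oU (sg i) Ux); apply: (@cvg_mx _ _ _ _ (nbhs z)) => a b.
  under eq_cvg do rewrite mxE.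
  by rewrite mxE; exact: (smooth_on_continuous (smooth_on_derive _ sF) Uz).
- by move=> X; exact: pGt.
- move=> X X0; rewrite bil_mxD bil_mxN bil_mxZ (hess_sqnorm0 oU (sg i) Ux).
  rewrite (sasakian0 sG Ux).
  have ge0 Y : 0 <= bil (g i x) Y Y.
    by have [->|/(pg i x Y Ux)/ltW//] := eqVneq Y 0; rewrite bil0l.
  have := ge0 (lsubmx X); have := ge0 (rsubmx X).
  have [l0|/(pg i x _ Ux) ?] := eqVneq (lsubmx X) 0; last by lra.
  have /(pg i x _ Ux) ? : rsubmx X != 0; last by lra.
  apply: contra_neq X0 => r0; by rewrite -[X]hsubmxK l0 r0 row_mx0.
- have /posdef_unit uG : posdef (Gt i z) by move=> X; exact: pGt.
  rewrite sqnorm_hess0 mulKmx// mxtrace_block mxtrace0 add0r mxtrace_scalar.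
  by rewrite -mulrnA ler_nat (leq_mul2l 2 2 n).
Qed.

End NearZeroSection.

(** The matrices A y - c are small perturbations of A x for y near x and c near 0. *)
Lemma posdef_coercive (R : realType) (T : topologicalType) m
    (A : T -> 'M[R]_m) x :
  {for x, continuous A} -> posdef (A x) ->
  exists2 c : R, 0 < c & \forall y \near x, posdef (A y - c%:M).
Proof.
move=> cA pA.
(* The pairs (y, c) tend to (x, 0) with c > 0. *)
have : \forall p \near filter_prod (nbhs x) (0 : R)^'+,
    posdef (A p.1 - p.2%:M).
  apply: (@near_posdef _ _ _ _ _ _ (A x)) => //.
  rewrite -[A x]subr0 -(raddf0 (@scalar_mx R m)); apply: cvgB.
    have c1 : p.1 @[p --> filter_prod (nbhs x) (0 : R)^'+] --> x.
      exact: cvg_fst.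
    exact: (cvg_comp _ _ c1 cA).
  apply: cvg_mx => k l; under eq_cvg do rewrite mxE.
  rewrite mxE; apply: cvgMn.
  have c2 : p.2 @[p --> filter_prod (nbhs x) (0 : R)^'+] --> (0 : R)^'+.
    exact: cvg_snd.
  by apply: (cvg_trans c2); exact: cvg_within.
case=> -[P Q] [/= nP nQ] PQ.
have [c [c0 Qc]] : exists c : R, 0 < c /\ Q c.
  apply: (@filter_ex _ (0 : R)^'+); apply: filterI nQ; exact: nbhs_right_gt.
by exists c => //; apply: filterS nP => y Py; exact: (PQ (y, c)).
Qed.

Lemma sqr_norm_le_bil1 (R : realType) m (y : 'rV[R]_m) :
  `|y| ^+ 2 <= bil 1%:M y y.
Proof.
have E : bil 1%:M y y = \sum_j y 0 j ^+ 2.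
  by rewrite /bil mulmx1 mxE; apply: eq_bigr => j _; rewrite mxE.
have [->|/eqP y0] := eqVneq (`|y|) 0.
  by rewrite expr0n E sumr_ge0// => j _; exact: sqr_ge0.
have [[k j] yE] := mx_norm_neq0 (introN eqP y0).
have -> : `|y| = `|y k j| by exact: yE.
rewrite real_normK ?num_real//= E ord1 (bigD1 j)//= lerDl.
by apply: sumr_ge0 => l _; exact: sqr_ge0.
Qed.

(** By coercivity, c |v|^2 <= r^2 for all base points near x, so short vectors for
g are close to the zero section of the chart. *)
Lemma small_vectors (R : realType) n (g : 'rV[R]_n -> 'M[R]_n) x
    (P : set 'rV[R]_(n + n)) :
  {for x, continuous g} -> posdef (g x) -> nbhs (row_mx x 0) P ->
  \forall y \near x & r \near (0 : R)^'+,
    forall v, bil (g y) v v = r ^+ 2 -> P (row_mx y v).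
Proof.
move=> cg pg nP; have [c c0 pc] := posdef_coercive cg pg.
have : \forall p \near (x, 0 : 'rV[R]_n), P (row_mx p.1 p.2).
  have : row_mx p.1 p.2 @[p --> (x, 0 : 'rV[R]_n)]
      --> (row_mx x 0 : 'rV[R]_(n + n)).
    apply: cvg_mx => k l; under eq_cvg do rewrite mxE.
    rewrite mxE; case: splitP => j _; apply: cvg_entry.
      exact: cvg_fst.
    exact: cvg_snd.
  exact.
case=> -[X Y] [/= nX /nbhs_ballP[e /= e0 eY]] XY.
have r2 : \forall r \near (0 : R)^'+, r ^+ 2 < c * e ^+ 2.
  have : (fun r : R => r * r) @ (0 : R)^'+ --> (0 : R).
    by rewrite -[in X in _ --> X](mulr0 0); apply: cvgM; exact: cvg_within.
  move/cvgr_lt; apply; by rewrite mulr_gt0 ?exprn_gt0.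
near=> y r => v vr.
apply: (XY (y, v)); split => /=; first by near: y.
apply: eY; rewrite -ball_normE/= sub0r normrN.
have : c * `|v| ^+ 2 < c * e ^+ 2.
  apply: le_lt_trans (_ : r ^+ 2 < _); last by near: r.
  rewrite -vr; have pv : posdef (g y - c%:M) by near: y.
  apply: le_trans (_ : bil c%:M v v <= _).
    by rewrite -scalemx1 bil_mxZ ler_pM2l// sqr_norm_le_bil1.
  have [->|/pv] := eqVneq v 0; first by rewrite !bil0l.
  by rewrite bil_mxD bil_mxN subr_gt0 => /ltW.
by rewrite ltr_pM2l// ltr_pXn2r ?nnegrE// ltW.
Unshelve. all: by end_near. Qed.

(** * Changes of charts and the theorem *)

Section ChangeOfCoordinates.
Variables (R : realType) (m : nat) (U1 U2 O : set 'rV[R]_m).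
Variables (F1 F2 : 'rV[R]_m -> R) (t : 'rV[R]_m -> 'rV[R]_m).
Hypotheses (oU1 : open U1) (oU2 : open U2) (oO : open O).
Hypotheses (sF1 : smooth_on U1 F1) (sF2 : smooth_on U2 F2) (st : smooth_on O t).
Hypotheses (OU1 : O `<=` U1) (OU2 : forall w, O w -> U2 (t w)).
Hypothesis F12 : forall w, O w -> F1 w = F2 (t w).

Let dt w : O w -> differentiable t w.
Proof. exact: smooth_on_differentiable. Qed.

Let dF2 w : U2 w -> differentiable F2 w.
Proof. exact: smooth_on_differentiable. Qed.

Lemma derive_pullback w X : O w -> 'D_X F1 w = 'D_('D_X t w) F2 (t w).
Proof.
move=> Ow; rewrite -(derive_comp X (dt Ow) (dF2 (OU2 Ow))).
by apply: near_eq_derive; apply: (open_near_eq oO) Ow.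
Qed.

Lemma grad_pullback w : O w -> grad F1 w = jacobian t w *m grad F2 (t w).
Proof.
move=> Ow; apply/colP => a.
rewrite mxE derive_pullback// -(mul_grad sF2 _ (OU2 Ow)) deriveEjacobian//.
  by rewrite -mulmxA -rowE mxE.
exact: dt.
Qed.

(** Second derivatives of F2 o t produce the extra term dF2(D_X D_Y t), which is
exactly the defect of tensoriality of the connection coefficients. *)
Lemma hess_pullback (G1 G2 : 'I_m -> 'M[R]_m) w : O w ->
  (forall X Y, 'D_(christoffel G1 X Y) t w
     = 'D_X (fun u => 'D_Y t u) w + christoffel G2 ('D_X t w) ('D_Y t w)) ->
  hess F1 G1 w = jacobian t w *m hess F2 G2 (t w) *m (jacobian t w)^T.
Proof.
move=> Ow G12; apply: bil_inj => X Y.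
rewrite bil_congr -!deriveEjacobian; try exact: dt.
rewrite (bil_hess oU1 sF1 _ _ _ (OU1 Ow)) (bil_hess oU2 sF2 _ _ _ (OU2 Ow)).
rewrite derive_pullback// G12 derive_dirD; last exact/dF2/OU2.
rewrite (near_eq_derive _ (g := fun u => 'D_('D_Y t u) F2 (t u))); last first.
  by apply: (open_near_eq oO) Ow => u Ou; exact: derive_pullback.
rewrite (derive_along oU2 sF2 X (OU2 Ow) (dt Ow)) ?opprD ?addrA; last first.
  exact: smooth_on_differentiable (smooth_on_derive Y st) Ow.
by rewrite [_ + 'D_('D_X t w) _ _]addrC addrK.
Qed.

End ChangeOfCoordinates.

(** The second component is linear in the fibre coordinate, with coefficients the
partial derivatives of t. *)
Lemma smooth_on_tangent_map (R : realType) n (O : set 'rV[R]_n)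
    (t : 'rV[R]_n -> 'rV[R]_n) : open O -> smooth_on O t ->
  smooth_on (tangent_dom O)
    (fun z : 'rV[R]_(n + n) => row_mx (t (lsubmx z)) ('D_(rsubmx z) t (lsubmx z))).
Proof.
move=> oO st; have oT := open_tangent_dom oO.
have sl f : smooth_on O f -> smooth_on (tangent_dom O) (f \o lsubmx).
  by move=> sf; exact: smooth_on_comp_linear oO (@continuous_lsubmx _ 1 n n) sf.
apply: smooth_on_mx => // a j; rewrite (ord1 a).
case: (split_ordP j) => k ->.
  apply: (smooth_on_eq oT (f := fun z => t (lsubmx z) 0 k)).
    by move=> z _; rewrite row_mxEl.
  by apply: smooth_on_entry => //; exact: sl.
apply: (smooth_on_eq oT (f := \sum_b ((fun z => rsubmx z 0 b) *
    (fun z => ('D_(delta_mx 0 b) t (lsubmx z)) 0 k)))).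
  move=> z Oz; rewrite row_mxEr derive_coord; last first.
    exact: smooth_on_differentiable st Oz.
  by rewrite fct_sumE summxE; apply: eq_bigr => b _; rewrite mxE.
apply: smooth_on_sum => // b; apply: smooth_on_mul => //;
  apply: smooth_on_entry => //.
  exact: smooth_on_linear oT (@continuous_rsubmx _ 1 n n).
exact: sl (smooth_on_derive _ st).
Qed.

Section ChartChange.
Variables (R : realType) (n : nat) (C : charts R n).
Variables (g : metric_field C) (Gt : metric_field (tangent_charts C)).
Variable D : christoffel_field (tangent_charts C).
Hypotheses (rg : riemannian g) (rGt : riemannian Gt) (cD : connection D).
Hypothesis oU : forall i, open (chart_image C i).
Variables (i j : chart_index C).
Hypothesis oO : open (overlap C i j).
Hypothesis st : smooth_on (overlap C i j) (transition C i j).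
Hypothesis OU1 : overlap C i j `<=` chart_image C i.
Hypothesis OU2 : forall x, overlap C i j x -> chart_image C j (transition C i j x).

Lemma pinched_at_transition eps z : overlap C i j (lsubmx z) ->
  pinched_at g Gt D eps j (transition (tangent_charts C) i j z) ->
  pinched_at g Gt D eps i z.
Proof.
move=> Oz; set t := transition (tangent_charts C) i j.
have [sg _ _ tg] := rg; have [_ _ pGt tGt] := rGt.
have stt : smooth_on (tangent_dom (overlap C i j)) t := smooth_on_tangent_map oO st.
have F12 w : tangent_dom (overlap C i j) w -> sqnorm (g i) w = sqnorm (g j) (t w).
  by move=> Ow; rewrite /sqnorm (tg i j)// row_mxKl row_mxKr.
have TU2 w : tangent_dom (overlap C i j) w -> tangent_dom (chart_image C j) (t w).
  by move=> Ow; rewrite /tangent_dom/= row_mxKl; exact: OU2.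
have TU1 : tangent_dom (overlap C i j) `<=` tangent_dom (chart_image C i).
  by move=> w; exact: OU1.
have sF k := smooth_on_sqnorm (@oU k) (sg k).
have Tz : tangent_dom (overlap C i j) z := Oz.
have GE : Gt i z = jacobian t z *m Gt j (t z) *m (jacobian t z)^T.
  apply: bil_inj => X Y; rewrite bil_congr (tGt i j)// -!deriveEjacobian//.
  exact: smooth_on_differentiable stt Tz.
  exact: smooth_on_differentiable stt Tz.
rewrite /pinched_at /sqnorm_hess GE.
rewrite (grad_pullback (open_tangent_dom oO) (sF j) stt TU2 F12 Tz).
rewrite (hess_pullback (open_tangent_dom (@oU i)) (open_tangent_dom (@oU j))
  (open_tangent_dom oO) (sF i) (sF j) stt TU1 TU2 F12 (G2 := D j (t z)) Tz); last first.
  by move=> X Y; exact: cD.2.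
apply: pinched_congr; last first.
  by apply: posdef_unit => X; apply: pGt; exact: TU2.
have : Gt i z \in unitmx.
  by apply: posdef_unit => X; apply: pGt; exact: TU1.
(* The Jacobian is invertible because it carries one metric to the other. *)
by rewrite GE !unitmx_mul => /andP[/andP[]].
Qed.

End ChartChange.

Lemma chart_overlap_open (R : realType) (M : topologicalType) n
    (A : smooth_manifold R M n) (i j : chart A) :
  open (overlap (charts_of A) i j).
Proof.
rewrite openE => _ [p [ip jp] <-].
have Uip : (chart_map i @` chart_dom i) (chart_map i p) by exists p.
have ci := chart_inv_continuous Uip.
rewrite /interior; near=> x.
have [q iq qx] : (chart_map i @` chart_dom i) x.
  by near: x; apply: open_nbhs_nbhs; split => //; exact: chart_map_open.
exists q => //; split => //.
have -> : q = chart_inv i x by rewrite -qx chart_mapK.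
near: x; apply: ci; apply: open_nbhs_nbhs; split; first exact: chart_dom_open.
by rewrite chart_mapK.
Unshelve. all: by end_near. Qed.

Theorem theorem3p5 (R : realType) (M : topologicalType) (n : nat)
    (A : smooth_manifold R M n)
    (g : metric_field (charts_of A)) (G : christoffel_field (charts_of A))
    (Gt : metric_field (tangent_charts (charts_of A)))
    (D : christoffel_field (tangent_charts (charts_of A)))
    (L : R) :
  n <> 1%N ->
  compact [set: M] ->
  statistical g G ->
  sasakian g G Gt ->
  levi_civita Gt D ->
  exists2 r : R, 0 < r &
    forall (i : chart A) (z N : 'rV[R]_(n + n)) (H : R),
      sphere_bundle g r i z ->
      unit_normal (Gt i) (sphere_bundle g r i) z N ->
      mean_curvature (Gt i) (D i) (sphere_bundle g r i) z N H ->
      L < `|H|.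
Proof.
move=> n1 cM [rg _ _ _] sG [cD _ _].
have [rGt _] := sG.
have [sg _ pg _] := rg; have [_ symGt pGt _] := rGt.
have oU (i : chart A) : open (chart_image (charts_of A) i).
  exact: chart_map_open.
case: (ltnP 1 n) => [n2|]; last first.
  (* In dimension 0, all vectors are zero and the spheres are empty. *)
  case: n n1 A g G Gt D {cM rg sG cD rGt sg pg symGt pGt oU} => [|[]]// _.
  move=> A g G Gt D _.
  exists 1 => // i z N H [_]; rewrite bilE big_ord0 expr1n => /eqP.
  by rewrite eq_sym oner_eq0.
(* A pinched point satisfies |H| >= 1 / eps = |L| + 1. *)
pose eps := (`|L| + 1)^-1.
have eps0 : 0 < eps by rewrite invr_gt0 ltr_wpDl.
(* Charts are quantified inside, so that the property concerns a point of M and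
   can be obtained by compactness. *)
pose good (r : R) (q : M) := forall (i : chart A) (z : 'rV[R]_(n + n)),
  chart_dom i q -> lsubmx z = chart_map i q -> sqnorm (g i) z = r ^+ 2 ->
  pinched_at g Gt D eps i z.
have {cM} : \forall r \near (0 : R)^'+, [set: M] `<=` good r.
  move/compact_near_coveringP: cM; apply => p _.
  (* One chart around p is used to estimate all the charts around points q. *)
  have [j jp] := chart_cover A p.
  set x := chart_map j p.
  have Ux : chart_image (charts_of A) j x by exists p.
  have := small_vectors (smooth_on_continuous (sg j) Ux) (pg j x ^~ Ux)
    (near_zero_section rg sG cD n2 (oU j) Ux eps0).
  case=> -[X Y] [/= nX nY] XY.
  exists (chart_dom j `&` chart_map j @^-1` X, Y) => /=.
    split=> //; apply: filterI; last exact: chart_map_continuous jp _ nX.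
    exact: open_nbhs_nbhs (conj (chart_dom_open j) jp).
  move=> [q r] [/= [jq Xq] Yr] i z iq zq zr.
  have Oz : overlap (charts_of A) i j (lsubmx z) by exists q.
  have tz : transition (charts_of A) i j (lsubmx z) = chart_map j q.
    by rewrite /= zq chart_mapK.
  apply: (pinched_at_transition rg rGt cD oU _ _ _ _ Oz).
  - exact: chart_overlap_open.
  - exact: transition_smooth.
  - by move=> _ [q' [iq' _] <-]; exists q'.
  - by move=> _ [q' [iq' jq'] <-]; exists q' => //=; rewrite chart_mapK.
  have [_ _ _ tg] := rg.
  pose v := 'D_(rsubmx z) (transition (charts_of A) i j) (lsubmx z).
  have -> : transition (tangent_charts (charts_of A)) i j z
      = row_mx (chart_map j q) v by rewrite -tz.
  have /= P := XY (chart_map j q, r) (conj Xq Yr).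
  by apply: P; rewrite -zr /sqnorm (tg i j)// tz.
move=> /(filterI (nbhs_right_gt (0 : R)))/filter_ex[r [r0 rgood]].
exists r => // i z N H Sz uN mH; have [Uz Fz] := Sz.
have [NN _] := uN.
have [q iq qz] := Uz.
have [trN dN] := rgood q I i z iq (esym qz) Fz N NN.
have SU : sphere_bundle g r i `<=` tangent_dom (chart_image (charts_of A) i).
  by move=> w [].
have SF w : sphere_bundle g r i w -> sqnorm (g i) w = r ^+ 2 by case.
have pz : posdef (Gt i z) by move=> X; exact: pGt.
have := mean_curvature_level (open_tangent_dom (@oU i))
  (smooth_on_sqnorm (@oU i) (sg i)) SU SF Sz pz (symGt i z Uz) uN mH.
move: dN; set l := (_ *m _) 0 0 => dN lH.
have : 1 <= eps * `|H|.
  apply: (@le_trans _ _ (`|l * H|)); last by rewrite normrM ler_wpM2r.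
  by rewrite lH -normrN opprB; exact: le_trans trN (ler_norm _).
rewrite /eps ler_pdivlMl ?mulr1; last by rewrite ltr_wpDl.
by apply: lt_le_trans; rewrite ltr_pwDr// ler_norm.
Qed.
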